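(* Let $G$ be a connected graph and let $A_1,A_2,\dots,A_s$ be a sequence of pairwise disjoint independent vertex sets such that: (i) setting $G_0=G$ and $G_i=G_{i-1}-A_i$, each $G_i$ ($i=1,\dots,s$) is connected; (ii) each vertex of $A_i$ ($i=1,\dots,s$) has odd degree in $G_{i-1}$. Then for $i=0,1,\dots,s-1$, $$\gamma_M(G_i)\ \ge\ \frac12\sum_{v\in A_{i+1}}\bigl(d_{G_i}(v)-1\bigr)+\gamma_M(G_{i+1}).$$ In particular, if one of the graphs $G_1,G_2,\dots,G_s$ is upper embeddable, then $G$ is upper embeddable.
   Context: The maximum genus $\gamma_M(H)$ of a connected graph $H$ is the maximum integer $k$ such that $H$ has a (cellular) embedding in the orientable surface of genus $k$. The cycle rank of $H$ is $\beta(H)=|E(H)|-|V(H)|+1$. A connected graph $H$ is upper embeddable if $\gamma_M(H)=\lfloor \beta(H)/2\rfloor$. $d_{G_i}(v)$ is the degree of $v$ in $G_i$. *)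

(* Defs.v *)
From mathcomp Require Import all_boot all_order all_fingroup all_algebra.

Set Implicit Arguments.
Unset Strict Implicit.
Unset Printing Implicit Defensive.

(* Finite multigraphs; loops and parallel edges are allowed.  The vertices and
   edges are subsets of ambient finite types, so that a graph and its subgraphs
   have the same type.  The orientation of e from [tail e] to [head e] is only
   a device to name its two ends. *)
Record mgraph (V E : finType) := MGraph {
  verts : {set V};
  edges : {set E};
  tail : E -> V;
  head : E -> V;
  ends_verts : forall e, e \in edges -> (tail e \in verts) && (head e \in verts)
}.

Section Graphs.
Variables V E : finType.
Implicit Types (H : mgraph V E) (A : {set V}).

(* A dart (e, b) is one of the two half-edges of e; a loop has both of its
   darts at the same vertex and hence contributes 2 to the degree. *)
Definition darts H : {set E * bool} := [set d | d.1 \in edges H].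

Definition origin H (d : E * bool) : V := if d.2 then head H d.1 else tail H d.1.

Definition darts_at H (v : V) : {set E * bool} :=
  [set d in darts H | origin H d == v].

Definition degree H (v : V) : nat := #|darts_at H v|.

Definition adjacent H : rel V := fun u v =>
  [exists d in darts H, (origin H d == u) && (origin H (d.1, ~~ d.2) == v)].

Definition connected H : bool :=
  (verts H != set0) &&
  [forall u in verts H, forall v in verts H, connect (adjacent H) u v].

(* A vertex carrying a loop belongs to no independent set. *)
Definition independent H A : bool :=
  (A \subset verts H) &&
  [forall e in edges H, ~~ ((tail H e \in A) && (head H e \in A))].

Lemma del_verts_ends H A e :
    e \in [set e in edges H | (tail H e \notin A) && (head H e \notin A)] ->
  (tail H e \in verts H :\: A) && (head H e \in verts H :\: A).
Proof.
rewrite !inE => /andP[eH /andP[-> ->]] /=.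
exact: ends_verts eH.
Qed.

Definition del_verts H A : mgraph V E := MGraph (@del_verts_ends H A).

(* Cellular embeddings of a connected graph in oriented closed surfaces, up to
   homeomorphism, are encoded by rotation systems: a cyclic order of the darts
   at each vertex.  The permutation is required to be the identity outside of
   the darts of H. *)
Definition rotation_system H (r : {perm E * bool}) : bool :=
  perm_on (darts H) r &&
  [forall d in darts H, porbit r d == darts_at H (origin H d)].

Lemma flip_inj : injective (fun d : E * bool => (d.1, ~~ d.2)).
Proof. by move=> [e b] [e' b'] [-> /negb_inj ->]. Qed.

Definition flip : {perm E * bool} := perm flip_inj.

(* Faces are traced by crossing an edge and then turning to the next dart in
   the rotation.  An isolated vertex (which a connected graph has only if it
   is a single vertex without edges) has no dart, but the sphere in which it
   is embedded has one face. *)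
Definition nb_faces H (r : {perm E * bool}) : nat :=
  #|[set porbit (flip * r)%g d | d in darts H]| +
  #|[set v in verts H | degree H v == 0]|.

(* Euler's formula |V| - |E| + |F| = 2 - 2k for a connected graph. *)
Definition embeds_in_genus H (k : nat) : bool :=
  [exists r : {perm E * bool}, rotation_system H r &&
     (#|verts H| + nb_faces H r + 2 * k == #|edges H| + 2)].

(* The bound on k excludes no embedding, see [max_genus_spec]. *)
Definition max_genus H : nat :=
  \max_(k < #|edges H|.+2 | embeds_in_genus H k) k.

Lemma max_genus_spec H : (exists k, embeds_in_genus H k) ->
  embeds_in_genus H (max_genus H) /\
  forall k, embeds_in_genus H k -> k <= max_genus H.
Proof.
have bnd k : embeds_in_genus H k -> k < #|edges H|.+2.
  case/existsP=> r /andP[_ /eqP Eul].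
  have le2k : 2 * k <= #|edges H| + 2 by rewrite -Eul leq_addl.
  rewrite ltnS -(leq_pmul2l (isT : 0 < 2)); apply: leq_trans le2k _.
  by rewrite mulnS addnC leq_add2l leq_pmull.
case=> k0 Hk0; split.
  rewrite /max_genus (bigmax_eq_arg (Ordinal (bnd _ Hk0))) //.
  by case: arg_maxnP.
by move=> k Hk; apply: (leq_bigmax_cond (Ordinal (bnd _ Hk))).
Qed.

(* The truncated subtraction is exact: |E| + 1 >= |V| if H is connected. *)
Definition cycle_rank H : nat := #|edges H| + 1 - #|verts H|.

Definition upper_embeddable H : bool := max_genus H == (cycle_rank H)./2.

Fixpoint del_seq H (A : nat -> {set V}) (i : nat) : mgraph V E :=
  if i is j.+1 then del_verts (del_seq H A j) (A j.+1) else H.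

End Graphs.

(* Main.v *)
(* A vertex v of odd degree 2m+1 is put back into an embedded graph one edge at a
   time.  Its first edge is pendant and costs no face.  The other edges come in
   pairs, each of which can be drawn without creating a face: if the first edge
   merges two faces, the second one creates at most one; if it splits a face,
   then v lies on two faces, and one of them differs from a face at the far end
   of the second edge, which can be drawn so as to merge these two.  So the
   number of faces does not grow while the cycle rank grows by 2m, that is, the
   genus grows by at least m.

   In terms of the permutations, the faces are the cycles of [flip * r].
   Inserting a dart a after p in the rotation r multiplies this product by the
   transposition of [flip p] and [flip a].  The rotation is the identity outside
   of its darts, so that an edge not yet drawn counts for one more cycle; an
   isolated vertex is counted as a face of its own. *)
From mathcomp Require Import all_boot all_order all_fingroup all_algebra.
From mathcomp Require Import zify.
Require Import Defs.

Set Implicit Arguments.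
Unset Strict Implicit.
Unset Printing Implicit Defensive.

Lemma porbit_stable (T : finType) (s : {perm T}) (X : {set T}) x :
  {in X, forall y, s y \in X} -> x \in X -> porbit s x \subset X.
Proof.
move=> sX xX; apply/subsetP => _ /porbitP[i ->].
by elim: i => [|i IHi]; rewrite ?expg0 ?perm1 // expgSr permM sX.
Qed.

(** * Inserting one dart into a rotation *)

Section Insertion.
Variables (V E : finType) (H : mgraph V E).
Implicit Types (D : {set E * bool}) (S : {set E}) (r : {perm E * bool}).
Implicit Types (a b d p q : E * bool).

Local Notation flip := (flip E).

Definition dart_set S : {set E * bool} := [set d | d.1 \in S].

Definition at_vertex D v : {set E * bool} := [set d in D | origin H d == v].

(** [D] need not be closed under [flip]: this covers the stage at which only one half of an edge has
    been inserted. *)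
Definition rotates D r :=
  perm_on D r && [forall d in D, porbit r d == at_vertex D (origin H d)].

Definition isolated D := [set v in verts H | at_vertex D v == set0].

Definition nb_orbits r := #|porbits (flip * r)|.

Definition face r d : {set E * bool} := porbit (flip * r) d.

Definition add_dart a D : {set E * bool} := a |: D.

Definition face_count D r := nb_orbits r + #|isolated D|.

Definition insert_dart p a r : {perm E * bool} := (tperm p a * r)%g.

(* A dart after which [a] can be inserted in the rotation; at an isolated
   vertex this is [a] itself, and the insertion [tperm a a] is trivial. *)
Definition slot D a p :=
  if at_vertex D (origin H a) == set0 then p == a
  else p \in at_vertex D (origin H a).

Lemma flipE d : flip d = (d.1, ~~ d.2).
Proof. by rewrite permE. Qed.

Lemma flipK : involutive flip.
Proof. by case=> e x; rewrite !flipE /= negbK. Qed.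

Lemma flip_tperm p a r : (flip * (tperm p a * r) = tperm (flip p) (flip a) * (flip * r))%g.
Proof.
apply/permP => d; rewrite !permM; congr (r _).
case: (tpermP (flip p) (flip a) d) => [->|->|dp da].
- by rewrite !flipK tpermL.
- by rewrite !flipK tpermR.
- by rewrite tpermD //; apply/eqP => pd; [case: dp | case: da]; rewrite pd flipK.
Qed.

Lemma face_step r d d' : d' \in face r d -> (flip * r)%g d' \in face r d.
Proof.
rewrite /face -!eq_porbit_mem => /eqP <-.
by rewrite eq_porbit_mem (mem_porbit _ 1).
Qed.

(** Multiplying by a transposition splits a cycle containing both points and merges two cycles that
    separate them; for [p = a] nothing changes. *)
Lemma nb_orbits_insert p a r :
  nb_orbits (insert_dart p a r) + (flip p \notin face r (flip a)).*2 =
  nb_orbits r + (p != a).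
Proof.
by rewrite /nb_orbits flip_tperm porbits_mul_tperm (inj_eq perm_inj).
Qed.

Lemma insert_dartK p a : involutive (insert_dart p a).
Proof. by move=> r; rewrite /insert_dart mulgA tperm2 mul1g. Qed.

Lemma mem_flip S d : (flip d \in dart_set S) = (d \in dart_set S).
Proof. by rewrite flipE !inE. Qed.

Lemma rotates_notin D r d : rotates D r -> d \notin D -> r d = d.
Proof. by case/andP=> rD _; apply: out_perm. Qed.

Lemma rotates_in D r d : rotates D r -> (r d \in D) = (d \in D).
Proof. by case/andP=> /perm_closed. Qed.

Lemma rotates_porbit D r d :
  rotates D r -> d \in D -> porbit r d = at_vertex D (origin H d).
Proof. by case/andP=> _ /forall_inP rD /rD/eqP. Qed.

Lemma rotates_origin D r d : rotates D r -> origin H (r d) = origin H d.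
Proof.
move=> rD; case: (boolP (d \in D)) => dD; last by rewrite (rotates_notin rD).
have: r d \in porbit r d by exact: (mem_porbit r 1).
by rewrite (rotates_porbit rD dD) inE => /andP[_ /eqP].
Qed.

Lemma exists_slot D a : exists p, slot D a p.
Proof.
rewrite /slot; case: eqP => [_|/eqP/set0Pn[p pD]]; last by exists p.
by exists a.
Qed.

Lemma slot_neq D a p :
  slot D a p -> p != a -> p \in D /\ origin H p = origin H a.
Proof.
by rewrite /slot; case: eqP => [_ /eqP->|_]; rewrite ?eqxx // inE => /andP[? /eqP].
Qed.

Lemma in_add_dart a D d : (d \in add_dart a D) = (d == a) || (d \in D).
Proof. by rewrite in_setU1. Qed.

(** Away from an isolated vertex, the new rotation sends [p] to [a] and [a] to [r p]. Old orbits
    stay inside new ones, and no new orbit leaves its vertex because origins are preserved. *)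
Lemma rotates_insert D r a p :
  rotates D r -> a \notin D -> slot D a p -> rotates (add_dart a D) (insert_dart p a r).
Proof.
move=> rD aD sl.
have ra : r a = a by apply: rotates_notin rD aD.
case: (eqVneq p a) => [pa|pa].
  move: sl; rewrite /insert_dart pa tperm1 mul1g /slot.
  case: eqP => [at0 _|_]; last by rewrite inE (negPf aD).
  have at_a d : d \in D -> origin H d != origin H a.
    by move=> dD; apply/eqP => oda; move/setP/(_ d): at0; rewrite !inE dD oda eqxx.
  apply/andP; split.
    by case/andP: rD => rD _; apply: subset_trans rD (subsetUr _ _).
  apply/forall_inP => d; rewrite !inE => /predU1P[->|dD].
    apply/eqP/setP => d'; rewrite !inE; apply/idP/idP.
      by case/porbitP=> i ->; rewrite permX iter_fix // !eqxx.
    case/andP=> /predU1P[-> _|d'D]; first exact: porbit_id.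
    by rewrite (negPf (at_a _ d'D)).
  rewrite (rotates_porbit rD dD); apply/eqP/setP => d'; rewrite !inE.
  by case: (eqVneq d' a) => [->|//]; rewrite (negPf aD) /= eq_sym (negPf (at_a _ dD)).
have [pD op] := slot_neq sl pa.
set r' := insert_dart p a r.
have r'p : r' p = a by rewrite permM tpermL.
have r'a : r' a = r p by rewrite permM tpermR.
have r'D d : d != p -> d != a -> r' d = r d.
  by move=> dp da; rewrite permM tpermD // eq_sym.
have step d : d \in D -> r d \in porbit r' d.
  (* The old step from [p] to [r p] now passes through [a], hence two iterations. *)
  move=> dD; case: (eqVneq d p) => [->|dp].
    by rewrite -r'a -r'p -[r' (r' p)]/(iter 2 r' p) -permX mem_porbit.
  by rewrite -r'D ?(mem_porbit r' 1) //; apply: contraNneq aD => <-.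
have sub d : d \in D -> porbit r d \subset porbit r' d.
  move=> dD; apply: subset_trans (subsetIr D _); apply: porbit_stable; last first.
    by rewrite inE dD porbit_id.
  move=> y /setIP[yD yd]; rewrite inE (rotates_in _ rD) yD /=.
  have /eqP <- : porbit r' y == porbit r' d by rewrite eq_porbit_mem.
  exact: step.
have ap : a \in porbit r' p by rewrite -r'p (mem_porbit r' 1).
have r'o d : origin H (r' d) = origin H d.
  case: (eqVneq d p) => [->|dp]; first by rewrite r'p.
  case: (eqVneq d a) => [->|da]; first by rewrite r'a (rotates_origin _ rD).
  by rewrite r'D // (rotates_origin _ rD).
have r'in d : d \in add_dart a D -> r' d \in add_dart a D.
  case: (eqVneq d p) => [-> _|dp]; first by rewrite r'p setU11.
  case: (eqVneq d a) => [-> _|da]; first by rewrite r'a !inE (rotates_in _ rD) pD orbT.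
  by rewrite r'D // !inE (negPf da) /= (rotates_in _ rD) => ->; rewrite orbT.
apply/andP; split.
  apply/subsetP => d; apply: contraR; rewrite !inE negb_or => /andP[da dD].
  by rewrite r'D ?(rotates_notin rD) //; apply: contraNneq dD => ->.
have main d : d \in D -> porbit r' d = at_vertex (add_dart a D) (origin H d).
  move=> dD; apply/eqP; rewrite eqEsubset; apply/andP; split.
    apply: porbit_stable => [y|]; rewrite ![_ \in at_vertex _ _]in_set.
      by case/andP=> yD /eqP oy; rewrite r'o oy eqxx andbT r'in.
    by rewrite setU1r ?eqxx.
  have sD d' : d' \in D -> origin H d' = origin H d -> d' \in porbit r' d.
    move=> d'D od; apply: (subsetP (sub _ dD)).
    by rewrite (rotates_porbit rD dD) inE d'D od eqxx.
  apply/subsetP => d'; rewrite !inE => /andP[/predU1P[->|d'D] /eqP od]; last exact: sD.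
  have /eqP <- : porbit r' p == porbit r' d by rewrite eq_porbit_mem sD // op.
  exact: ap.
apply/forall_inP => d; rewrite in_setU1 => /predU1P[->|/main->//].
rewrite -op -main //; rewrite eq_porbit_mem //.
Qed.

(** A slot equals [a] exactly when the vertex of [a] was isolated, and only that vertex can cease to
    be so. *)
Lemma card_isolated_insert D a p :
  origin H a \in verts H -> slot D a p -> a \notin D ->
  #|isolated D| = #|isolated (add_dart a D)| + (p == a).
Proof.
move=> aV sl aD; have atU v : (at_vertex (add_dart a D) v == set0) =
    (at_vertex D v == set0) && (v != origin H a).
  apply/eqP/andP => [at0|[/eqP at0 va]].
    split; last first.
      by apply/eqP => va; move/setP/(_ a): at0; rewrite !inE va !eqxx.
    by apply/eqP/setP => d; move/setP/(_ d): at0; rewrite !inE => /negbT;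
      rewrite negb_and negb_or => /orP[/andP[_ /negPf->]|/negPf->]; rewrite ?andbF.
  apply/setP => d; move/setP/(_ d): at0; rewrite !inE => at0.
  by case: (eqVneq d a) => [->|] //=; rewrite eq_sym (negPf va).
have -> : isolated (add_dart a D) = isolated D :\ origin H a.
  by apply/setP => v; rewrite !inE atU andbA andbC.
rewrite addnC [LHS](cardsD1 (origin H a)); congr (_ + _).
rewrite inE aV; move: sl; rewrite /slot.
case: (at_vertex D (origin H a) == set0) => [->//|]; rewrite inE.
by case: (eqVneq p a) => [->|//]; rewrite (negPf aD).
Qed.


(** The corner between [p] and [r p] belongs to the face of [flip p], since [flip * r] takes
    [flip p] to [r p]; corners at [v] are therefore named by flipped darts. *)
Definition two_faces D r v := [exists p1 in at_vertex D v, exists p2 in at_vertex D v,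
  flip p1 \notin face r (flip p2)].

(** * Drawing one edge as two successive dart insertions *)

Section Edge.
Variables (S : {set E}) (r : {perm E * bool}) (a q : E * bool).
Hypothesis rS : rotates (dart_set S) r.
Hypothesis aH : a.1 \in edges H.
Hypothesis aS : a.1 \notin S.
Hypothesis sq : slot (dart_set S) (flip a) q.

Let b := flip a.
Let D := dart_set S.
Let r1 := insert_dart q b r.

Lemma origin_verts d : d.1 \in edges H -> origin H d \in verts H.
Proof. by move/ends_verts/andP=> [? ?]; rewrite /origin; case: ifP. Qed.

Let ab : a != b.
Proof. by apply/eqP; rewrite /b flipE; case: (a) => e [] []. Qed.

Let aD : a \notin D. Proof. by rewrite inE. Qed.
Let bD : b \notin D. Proof. by rewrite mem_flip. Qed.

Let abD : a \notin add_dart b D.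
Proof. by rewrite in_setU1 negb_or ab. Qed.

Lemma dart_setU1 : dart_set (a.1 |: S) = add_dart a (add_dart b D).
Proof.
apply/setP => -[e x]; rewrite !inE /b flipE; case: (a) => e' x' /=.
rewrite !xpair_eqE orbA -andb_orr; case: (e == e') => //=.
by case: x x' => [] [].
Qed.

Let r1D : rotates (add_dart b D) r1.
Proof. exact: rotates_insert. Qed.

Lemma old_face y : y \in D -> face r y \subset D.
Proof.
move=> yD; apply: porbit_stable => // z zD.
by rewrite permM (rotates_in _ rS) mem_flip.
Qed.

(** The rotation fixes both darts of an undrawn edge, so on them the face permutation reduces to
    [flip]. *)
Lemma new_face : face r a \subset [set a; b].
Proof.
have flip_r d : d \notin D -> (flip * r)%g d = flip d.
  by move=> dD; rewrite permM (rotates_notin rS) ?mem_flip.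
apply: porbit_stable; last by rewrite !inE eqxx.
by move=> y; rewrite !inE => /orP[]/eqP->; rewrite flip_r // /b ?flipK eqxx ?orbT.
Qed.

(** At an isolated vertex the permutation is unchanged and one isolated vertex is lost. Otherwise
    the cycle of the undrawn edge is merged into a face of drawn darts. *)
Lemma face_count_half : face_count (add_dart b D) r1 + 1 = face_count D r.
Proof.
have bV : origin H b \in verts H by apply: origin_verts; rewrite /b flipE.
rewrite /face_count (card_isolated_insert bV sq bD) -/D.
have := nb_orbits_insert q b r; rewrite -/r1 {2}/b flipK.
case: (eqVneq q b) => [->|qb].
  by rewrite /b flipK porbit_id; lia.
have [qD _] := slot_neq sq qb.
suff -> : flip q \notin face r a by lia.
rewrite porbit_sym; apply: contra aD; apply: subsetP.
by apply: old_face; rewrite mem_flip.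
Qed.

(** The first half costs one; the second costs one more, unless it splits a cycle and regains it. As
    the edge itself stops being counted, the alternatives mean one face fewer and one face more. *)
Lemma face_count_edge p : slot (add_dart b D) a p ->
  let r2 := insert_dart p a r1 in
  let D2 := dart_set (a.1 |: S) in
  rotates D2 r2 /\ (face_count D2 r2 + 2 = face_count D r
     \/ [/\ p != a, face_count D2 r2 = face_count D r, two_faces D2 r2 (origin H a)
        & flip p \in face r1 b]).
Proof.
move=> sp /=; rewrite dart_setU1; split; first exact: rotates_insert.
have aV := origin_verts aH.
have := face_count_half; rewrite /face_count (card_isolated_insert aV sp abD).
have := nb_orbits_insert p a r1; rewrite -/b.
case: (eqVneq p a) => [->|pa]; first by rewrite -/b porbit_id; left; lia.
case: (boolP (flip p \in _)) => [pb|_] /=; last by left; lia.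
move=> c2 c1; right; split => //; first by lia.
have [pD op] := slot_neq sp pa.
apply/exists_inP; exists p; first by rewrite inE setU1r // op eqxx.
apply/exists_inP; exists a; first by rewrite inE setU11 eqxx.
(* Repeating the insertion undoes the split, so it merges two cycles: [flip p] and [flip a] lie on
   different faces of the new rotation. *)
have := nb_orbits_insert p a (insert_dart p a r1).
rewrite insert_dartK pa.
by case: (_ \in _) => //=; lia.
Qed.

(** Inserting [b] after [q] can only enlarge the face of [flip q] by the two new darts, so a corner
    on another face remains separated from it. *)
Lemma separated_slot p :
  p \in D -> flip p \notin face r (flip q) ->
  flip p \notin face r1 b.
Proof.
move=> pD pq; set X := face r (flip q) :|: [set a; b].
have subX : face r1 b \subset X.
  apply: porbit_stable; last by rewrite !inE eqxx !orbT.
  pose phi := (flip * r)%g; have phiX y : y \in X -> phi y \in X.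
    case/setUP=> [yq|yab]; first by apply/setUP; left; apply: face_step.
    have : phi y \in [set a; b].
      apply: (subsetP new_face); move: yab; rewrite !inE => /orP[]/eqP->.
        exact: (mem_porbit _ 1).
      have -> : b = phi a by rewrite permM (rotates_notin rS).
      by do 2 apply: face_step; apply: porbit_id.
    by move=> yab'; apply/setUP; right.
  (* Both points exchanged by the transposition, [flip q] and [flip b = a], lie in [X], so [X] stays
     closed under the new face permutation. *)
  move=> y yX; rewrite flip_tperm permM; apply: phiX; case: tpermP => // _.
    by apply/setUP; right; rewrite /b flipK !inE eqxx.
  by apply/setUP; left; apply: porbit_id.
apply: contra pq => /(subsetP subX); rewrite 2!in_setU in_set1 in_set1.
case/or3P => // /eqP pE; have : flip p \in D by rewrite mem_flip.
  by rewrite pE (negPf aD).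
by rewrite pE (negPf bD).
Qed.

End Edge.

End Insertion.

(** * Drawing trees and stars of edges while bounding the number of faces *)

Section Drawn.
Variables (V E : finType) (H : mgraph V E) (N : nat).
Implicit Types (S T : {set E}) (r : {perm E * bool}) (a : E * bool) (W : {set V}).

Local Notation flip := (flip E).

(* [face_count] is the number of faces (an isolated vertex having one) plus the
   number of edges outside of [S].  Drawing an edge lowers it by 0 or 2, hence the
   even slack; [k] is the part of the loss that is guaranteed. *)
Definition drawn S k := exists r j,
  rotates H (dart_set S) r /\ face_count H (dart_set S) r + k + j.*2 = N.

Definition isolated_in S v := at_vertex H (dart_set S) v == set0.

Lemma drawn_edge S k a :
  a.1 \in edges H -> a.1 \notin S -> drawn S k -> drawn (a.1 |: S) k.
Proof.
move=> aH aS [r [j [rS eN]]].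
have [q sq] := exists_slot H (dart_set S) (flip a).
have [p sp] := exists_slot H (add_dart (flip a) (dart_set S)) a.
have [rS2 [eq2|[_ eq2 _ _]]] := face_count_edge rS aH aS sq sp.
  by exists (insert_dart p a (insert_dart q (flip a) r)), j.+1; split; [exact: rS2|move: eq2 eN; clear; lia].
by exists (insert_dart p a (insert_dart q (flip a) r)), j; split; [exact: rS2|move: eq2 eN; clear; lia].
Qed.

(** The vertex of [a] is still isolated once [flip a] is inserted, so the slot is [a] itself; this
    rules out the splitting case, and the loss of 2 is certain. *)
Lemma drawn_pendant S k a :
  a.1 \in edges H -> a.1 \notin S -> isolated_in S (origin H a) ->
  origin H (flip a) != origin H a -> drawn S k -> drawn (a.1 |: S) (k + 2).
Proof.
move=> aH aS isoa na [r [j [rS eN]]].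
have [q sq] := exists_slot H (dart_set S) (flip a).
have sp : slot H (add_dart (flip a) (dart_set S)) a a.
  rewrite /slot ifT // -subset0; apply/subsetP => d.
  rewrite [_ \in at_vertex _ _ _]in_set in_add_dart => /andP[].
  case: (eqVneq d (flip a)) => [->|_ /= dS od]; first by rewrite (negPf na).
  by rewrite -(eqP isoa) inE dS.
have [rS2 [eq2|[/eqP//]]] := face_count_edge rS aH aS sq sp.
by exists (insert_dart a a (insert_dart q (flip a) r)), j; split; [exact: rS2|move: eq2 eN; clear; lia].
Qed.

(** Either the first edge already loses 2, or it leaves two faces at the common vertex, and the
    second edge can then be made to merge faces. *)
Lemma drawn_pair S k a1 a2 :
  a1.1 \in edges H -> a2.1 \in edges H -> a1.1 \notin S -> a2.1 \notin a1.1 |: S ->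
  origin H a1 = origin H a2 ->
  drawn S k -> drawn (a2.1 |: (a1.1 |: S)) (k + 2).
Proof.
move=> aH1 aH2 aS1 aS2 o12 [r [j [rS eN]]].
have [q sq] := exists_slot H (dart_set S) (flip a1).
have [p sp] := exists_slot H (add_dart (flip a1) (dart_set S)) a1.
have /= := face_count_edge rS aH1 aS1 sq sp.
move: (insert_dart p a1 _) => r1 [rS1 [eq1|[_ eq1 two _]]].
  apply: drawn_edge => //; exists r1, j; split; [exact: rS1|move: eq1 eN; clear; lia].
have [q' sq'] := exists_slot H (dart_set (a1.1 |: S)) (flip a2).
(* The corners of [p1] and [p2] lie on different faces, so at least one of them avoids the face at
   the far end [q']. *)
have [p' p'1 p'q'] : exists2 p', p' \in at_vertex H (dart_set (a1.1 |: S)) (origin H a2)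
    & flip p' \notin face r1 (flip q').
  rewrite -o12; case/exists_inP: two => p1 p1at /exists_inP[p2 p2at p12].
  case: (boolP (flip p1 \in face r1 (flip q'))) => [p1q|]; last by exists p1.
  exists p2 => //; apply: contra p12; move: p1q; rewrite /face -!eq_porbit_mem.
  by move=> /eqP -> /eqP ->.
have [p'D o'] : p' \in dart_set (a1.1 |: S) /\ origin H p' = origin H a2.
  by move: p'1; rewrite [_ \in at_vertex _ _ _]in_set => /andP[? /eqP].
have sp' : slot H (add_dart (flip a2) (dart_set (a1.1 |: S))) a2 p'.
  have p'at : p' \in at_vertex H (add_dart (flip a2) (dart_set (a1.1 |: S))) (origin H a2).
    by rewrite [_ \in at_vertex _ _ _]in_set in_add_dart p'D orbT o' eqxx.
  by rewrite /slot ifF //; apply/negP => /eqP at0; rewrite at0 inE in p'at.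
have /= := face_count_edge rS1 aH2 aS2 sq' sp'.
have /negPf -> := separated_slot rS1 aS2 p'D p'q'.
move: (insert_dart p' a2 _) => r2 [rS2 [eq2|[]//]].
by exists r2, j; split; [exact: rS2|move: eq2 eq1 eN; clear; lia].
Qed.

(** The missing edges may be drawn in any way, their effect being absorbed by the even slack. *)
Lemma drawn_subset S T k :
  S \subset T -> T \subset edges H -> drawn S k -> drawn T k.
Proof.
move=> ST TH; elim: {S}_.+1 {-2}S (ltnSn #|T :\: S|) ST => // n IHn S lt ST dS.
have [TS|/set0Pn[e /setDP[eT eS]]] := eqVneq (T :\: S) set0.
  by have -> : T = S by apply/eqP; rewrite eqEsubset ST andbT -setD_eq0 TS.
apply: (IHn (e |: S)); last 1 first.
- by apply: (drawn_edge (a := (e, true))) => //=; apply: (subsetP TH).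
- rewrite -setDDl setDDl setUC -setDDl; move: lt; rewrite (cardsD1 e) inE eS eT.
  by rewrite add1n ltnS.
- by rewrite subUset ST sub1set eT.
Qed.

Lemma drawn_even_star S k v (ds : seq (E * bool)) :
  {in ds, forall d, d.1 \in edges H /\ d.1 \notin S} ->
  {in ds, forall d, origin H d = v} -> uniq [seq d.1 | d <- ds] ->
  ~~ odd (size ds) -> drawn S k ->
  drawn ([set e in [seq d.1 | d <- ds]] :|: S) (k + size ds).
Proof.
have [n] := ubnP (size ds).
elim: n ds S k => // n IHn [|a1 [|a2 ds]] S k //=.
  move=> _ _ _ _ _; rewrite addn0.
  by congr (drawn _ _); apply/setP => e; rewrite !inE.
move=> lt_n dsH dsv /and3P[]; rewrite in_cons negb_or => /andP[n12 n1] n2 uds.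
rewrite negbK => odds dS.
have [aH1 aS1] := dsH a1 (mem_head _ _).
have [aH2 aS2] := dsH a2 (mem_behead (mem_head _ _ : a2 \in behead (_ :: a2 :: ds))).
have := IHn ds (a2.1 |: (a1.1 |: S)) (k + 2).
have -> : k + (size ds).+2 = k + 2 + size ds by rewrite -addnA.
have -> : [set e in [:: a1.1, a2.1 & [seq d.1 | d <- ds]]] :|: S =
  [set e in [seq d.1 | d <- ds]] :|: (a2.1 |: (a1.1 |: S)).
  by apply/setP => e; rewrite !inE -!orbA; do ?bool_congr.
apply=> //; first exact: ltnW.
- move=> d dds; have [|dH dS'] := dsH d; first by rewrite !inE dds !orbT.
  split=> //; rewrite !inE (negPf dS') orbF negb_or.
  by apply/andP; split; [apply: contraNneq n2|apply: contraNneq n1] => <-; apply: map_f.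
- by move=> d dds; apply: dsv; rewrite !inE dds !orbT.
- apply: drawn_pair => //; first by rewrite !inE negb_or eq_sym n12.
  by rewrite !dsv // !inE eqxx ?orbT.
Qed.

(** The pendant first edge yields 2 and the remaining even star yields its size, one less than that
    of [ds]. *)
Lemma drawn_odd_star S k v (ds : seq (E * bool)) :
  {in ds, forall d, d.1 \in edges H /\ d.1 \notin S} ->
  {in ds, forall d, origin H d = v /\ origin H (flip d) != v} ->
  uniq [seq d.1 | d <- ds] -> odd (size ds) -> isolated_in S v -> drawn S k ->
  drawn ([set e in [seq d.1 | d <- ds]] :|: S) (k + (size ds).+1).
Proof.
case: ds => // a ds dsH dsv /= /andP[na uds] odds iso dS.
have [aH aS] := dsH a (mem_head _ _); have [av fav] := dsv a (mem_head _ _).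
have -> : k + (size ds).+2 = k + 2 + size ds by rewrite -addnA.
have -> : [set e in a.1 :: [seq d.1 | d <- ds]] :|: S =
  [set e in [seq d.1 | d <- ds]] :|: (a.1 |: S).
  by apply/setP => e; rewrite !inE -!orbA; do ?bool_congr.
apply: (drawn_even_star (v := v)) => //.
- move=> d dds; have [|dH dS'] := dsH d; first by rewrite inE dds orbT.
  split=> //; rewrite !inE (negPf dS') orbF.
  by apply: contraNneq na => <-; apply: map_f.
- by move=> d dds; case: (dsv d) => //; rewrite inE dds orbT.
- by apply: drawn_pendant; rewrite ?av.
Qed.

End Drawn.

(** * From cycle counts to faces, and the existence of embeddings *)

Section Genus.
Variables V E : finType.
Implicit Types (H : mgraph V E) (A B W : {set V}) (S : {set E}).

(** Each undrawn edge [e] forms a cycle of its own, represented by [(e, false)], and no such cycle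
    meets a drawn dart. *)
Lemma nb_orbits_darts H S (r : {perm E * bool}) : rotates H (dart_set S) r ->
  nb_orbits r = #|[set face r d | d in dart_set S]| + #|~: S|.
Proof.
move=> rS; pose out e := face r (e, false).
have outP d : d.1 \notin S -> face r d \subset [set d; flip E d] := new_face rS.
have -> : #|~: S| = #|out @: ~: S|.
  rewrite card_in_imset // => e e'; rewrite !inE => eS _ eq_out.
  have /(subsetP (outP (e, false) eS)) : (e', false) \in face r (e, false).
    by rewrite -/(out e) eq_out; apply: porbit_id.
  by rewrite !inE flipE /= => /orP[]/eqP[].
have -> : nb_orbits r = #|[set face r d | d in dart_set S] :|: out @: ~: S|.
  congr #|pred_of_set _|; apply/setP => X; apply/imsetP/setUP => [[d _ ->]|].
    case: (boolP (d.1 \in S)) => dS; [left|right].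
      by apply/imsetP; exists d; rewrite ?inE.
    apply/imsetP; exists d.1; first by rewrite inE.
    case: d dS => e [] //= eS; apply/eqP; rewrite /out /face eq_porbit_mem porbit_sym.
    have := mem_porbit (flip E * r)%g 1 (e, true).
    by rewrite expg1 permM (rotates_notin rS) ?flipE //= inE.
  by case=> /imsetP[d _ ->]; [exists d | exists (d, false)].
rewrite cardsU (_ : _ :&: _ = set0) ?cards0 ?subn0 //.
apply/eqP; rewrite -subset0; apply/subsetP => X /setIP[/imsetP[d dS ->]].
case/imsetP=> e; rewrite inE => eS eq_f.
have : (e, false) \in face r d by rewrite eq_f; apply: porbit_id.
by move/(subsetP (old_face rS dS)); rewrite inE (negPf eS).
Qed.

Lemma nb_faces_face_count H (r : {perm E * bool}) : rotation_system H r ->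
  nb_faces H r + #|~: edges H| = face_count H (dart_set (edges H)) r.
Proof.
move=> rH; rewrite /face_count (@nb_orbits_darts H (edges H)) // addnAC.
congr (_ + _ + _); apply: eq_card => v.
by rewrite !inE -cards_eq0.
Qed.

Lemma drawn_edgeless H : drawn H (#|E| + #|verts H|) set0 0.
Proof.
have r1 : rotates H (dart_set set0) 1%g.
  apply/andP; split; first exact: perm_on1.
  by apply/forall_inP => d; rewrite !inE.
exists 1%g, 0; split=> //; rewrite !addn0 /face_count (nb_orbits_darts r1).
have -> : dart_set set0 = set0 :> {set E * bool} by apply/setP => d; rewrite !inE.
rewrite imset0 cards0 setC0 cardsT; congr (_ + _); apply: eq_card => v.
by rewrite !inE (_ : at_vertex _ _ _ = set0) ?eqxx ?andbT //; apply/setP=> d; rewrite !inE.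
Qed.

(** A path from [W] to an outside vertex must leave [W] somewhere. The dart starts at the outer end,
    where the edge will be pendant. *)
Lemma crossing_edge H W : connected H -> W \subset verts H -> W != set0 -> W != verts H ->
  exists2 d : E * bool, d.1 \in edges H &
    (origin H d \in verts H :\: W) && (origin H (flip E d) \in W).
Proof.
case/andP=> _ /forall_inP conn WH /set0Pn[w wW] WnH.
case: (boolP [exists d : E * bool, (d.1 \in edges H) && (origin H d \in verts H :\: W)
    && (origin H (flip E d) \in W)]) => [/existsP[d /andP[/andP[? ?] ?]]|no].
  by exists d => //; apply/andP.
case/negP: WnH; rewrite eqEsubset WH /=; apply/subsetP => v vH.
have /forall_inP/(_ v vH)/connectP[p] := conn w (subsetP WH _ wW).
elim: p w wW => [|x p IHp] w wW /=; first by move=> _ ->.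
case/andP=> wx; apply: IHp; move: wx => /exists_inP[d]; rewrite inE => dH.
case/andP=> /eqP ow /eqP ox; apply: contraR no => xW.
apply/existsP; exists (flip E d); rewrite flipK ow wW !flipE /= dH ox inE xW andbT /=.
by rewrite -ox; apply: origin_verts.
Qed.

(** A tree is grown by pendant edges, each losing 2. Keeping the ends of [S] within [W] ensures that
    the next vertex is isolated when it is reached. *)
Lemma drawn_tree H n : connected H -> n < #|verts H| ->
  exists W S, [/\ W \subset verts H, #|W| = n.+1, S \subset edges H,
    {in S, forall e, (tail H e \in W) && (head H e \in W)} &
    drawn H (#|E| + #|verts H|) S n.*2].
Proof.
move=> connH; elim: n => [|n IHn] ltn.
  case/card_gt0P: ltn => v vH; exists [set v], set0; split.
  - by rewrite sub1set.
  - by rewrite cards1.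
  - exact: sub0set.
  - by move=> e; rewrite in_set0.
  - exact: drawn_edgeless.
have [W [S [WH cW SH SW dS]]] := IHn (ltnW ltn).
have [||d dH /andP[/setDP[oH oW] fW]] := crossing_edge connH WH.
- by rewrite -card_gt0 cW.
- by apply: contraTneq ltn => <-; rewrite cW ltnn.
have oS e : e \in S -> forall x, origin H (e, x) \in W.
  by move=> eS x; case/andP: (SW e eS) => ? ?; rewrite /origin; case: ifP.
have dS' : d.1 \notin S by apply: contra oW => dS'; rewrite [d]surjective_pairing oS.
exists (origin H d |: W), (d.1 |: S); split.
- by rewrite subUset sub1set oH.
- by rewrite cardsU1 oW cW.
- by rewrite subUset sub1set dH.
- have dW x : origin H (d.1, x) \in origin H d |: W.
    rewrite !inE; case: (eqVneq x d.2) => [->|xd].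
      by rewrite -surjective_pairing eqxx.
    have -> : (d.1, x) = flip E d by rewrite flipE; case: (d.2) x xd => [] [].
    by rewrite fW orbT.
  move=> e /setU1P[->|eS]; first by rewrite (dW false) (dW true).
  by case/andP: (SW e eS) => ? ?; rewrite !inE; apply/andP; split; apply/orP; right.
- rewrite doubleS -addn2; apply: drawn_pendant => //.
    rewrite /isolated_in -subset0; apply/subsetP => -[e x]; rewrite inE => /andP[].
    by rewrite inE /= => eS /eqP od; rewrite -od oS in oW.
  by apply: contraNneq oW => <-.
Qed.

Lemma connected_embeds H : connected H -> exists k, embeds_in_genus H k.
Proof.
move=> connH; have V0 : 0 < #|verts H| by case/andP: connH; rewrite card_gt0.
have [|W [S [_ _ SH _]]] := @drawn_tree H #|verts H|.-1 connH; first by rewrite prednK.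
case/(drawn_subset SH (subxx _)) => r [j [rH eN]].
(* With a loss of twice [#|verts H| - 1] along a spanning tree, the count becomes Euler's formula
   with the slack [j] as genus. *)
exists j; apply/existsP; exists r; apply/andP; split=> //; apply/eqP.
have := nb_faces_face_count rH; have := cardsC (edges H).
move: eN; move: (face_count _ _ _) (nb_faces _ _) V0 => f n.
by clear; lia.
Qed.

Lemma embeds_max_genus H : connected H -> embeds_in_genus H (max_genus H).
Proof. by move/connected_embeds/max_genus_spec => []. Qed.

Lemma leq_max_genus H k : embeds_in_genus H k -> k <= max_genus H.
Proof. by move=> Hk; have [_ /(_ k Hk)] := max_genus_spec (ex_intro _ k Hk). Qed.

(** Both bounds follow from Euler's formula, since every embedding has at least one face. *)
Lemma max_genus_cycle_rank H : connected H ->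
  #|verts H| <= #|edges H| + 1 /\ max_genus H <= (cycle_rank H)./2.
Proof.
move=> connH; have /existsP[r /andP[rH /eqP euler]] := embeds_max_genus connH.
suff F0 : 0 < nb_faces H r by rewrite /cycle_rank; move: euler F0; clear; lia.
rewrite /nb_faces addn_gt0 !card_gt0.
case/andP: connH => /set0Pn[v vH] _; case: (boolP (degree H v == 0)) => dv.
  by apply/orP; right; apply/set0Pn; exists v; rewrite inE vH.
move: dv; rewrite cards_eq0 => /set0Pn[d]; rewrite inE => /andP[dH _].
by apply/orP; left; apply/set0Pn; exists (porbit (flip E * r)%g d); apply: imset_f.
Qed.

(** * Restoring the vertices of a deleted independent set one by one *)

Lemma independent_subset H A B : B \subset A -> independent H A -> independent H B.
Proof.
move=> BA /andP[AH /forall_inP indA]; rewrite /independent (subset_trans BA AH) /=.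
apply/forall_inP => e /indA; apply: contra => /andP[tB hB].
by rewrite !(subsetP BA).
Qed.

Lemma independent_del H A B :
  [disjoint A & B] -> independent H B -> independent (del_verts H A) B.
Proof.
move=> dAB /andP[BH /forall_inP indB]; apply/andP; split.
  by rewrite subsetD BH disjoint_sym.
by apply/forall_inP => e; rewrite inE => /andP[/indB].
Qed.

Lemma origin_flip_notin H A (d : E * bool) :
  independent H A -> d.1 \in edges H -> origin H d \in A -> origin H (flip E d) \notin A.
Proof.
case/andP=> _ /forall_inP indA /indA; rewrite flipE /origin /=.
by case: (d.2) => /= nAA oA; apply: contra nAA => ->; rewrite oA.
Qed.

Lemma mem_darts_at H v (d : E * bool) :
  (d \in darts_at H v) = (d.1 \in edges H) && (origin H d == v).
Proof. by rewrite !inE. Qed.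

(** By independence, the other ends of the edges at [v] are outside [A], so all these edges return
    together with [v]. *)
Lemma edges_del1 H A v : independent H A -> v \in A ->
  edges (del_verts H (A :\ v)) =
  [set e in [seq d.1 | d <- enum (darts_at H v)]] :|: edges (del_verts H A).
Proof.
move=> indA vA; apply/setP => e; rewrite in_setU in_set.
have -> : (e \in [seq d.1 | d <- enum (darts_at H v)]) =
    (e \in edges H) && ((tail H e == v) || (head H e == v)).
  apply/mapP/andP => [[[e' x]]|[eH /orP[]tv]].
  - rewrite mem_enum mem_darts_at /origin /= => /andP[eH ov] ->; split=> //.
    by case: x ov => ->; rewrite ?orbT.
  - by exists (e, false) => //; rewrite mem_enum mem_darts_at eH /origin.
  - by exists (e, true) => //; rewrite mem_enum mem_darts_at eH /origin.
rewrite !inE; case: (boolP (e \in edges H)) => //= eH.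
case/andP: indA => _ /forall_inP/(_ e eH).
case: (eqVneq (tail H e) v) => [->|_] /=; first by rewrite vA /= => /negPf ->; rewrite andbF.
case: (eqVneq (head H e) v) => [->|_] //=.
by rewrite vA andbT => ->.
Qed.

Section DeleteVertex.
Variables (H : mgraph V E) (A : {set V}) (v : V).
Hypothesis indA : independent H A.
Hypothesis vA : v \in A.

Let S := edges (del_verts H A).
Let ds := enum (darts_at H v).

Let dsP : {in ds, forall d, d.1 \in edges H /\ d.1 \notin S}.
Proof.
move=> d; rewrite mem_enum mem_darts_at => /andP[dH /eqP od]; split=> //.
rewrite inE dH /=; move: od; rewrite /origin; case: ifP => _ ->; rewrite vA //.
by rewrite andbF.
Qed.

Let ds_origin : {in ds, forall d, origin H d = v /\ origin H (flip E d) != v}.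
Proof.
move=> d; rewrite mem_enum mem_darts_at => /andP[dH /eqP od]; split=> //.
have oA : origin H d \in A by rewrite od.
by have := origin_flip_notin indA dH oA; apply: contraNneq => ->.
Qed.

Let ds_uniq : uniq [seq d.1 | d <- ds].
Proof.
(* Two darts of one edge at [v] would make a loop, which independence excludes. *)
rewrite map_inj_in_uniq ?enum_uniq // => -[e x] [e' x'] dx dx' /= ee'.
subst e'; have [ox fx] := ds_origin dx; have [ox' _] := ds_origin dx'.
case: (eqVneq x x') => [->//|xx']; case/negP: fx.
by rewrite flipE /= -ox'; case: x x' xx' {dx dx' ox ox'} => [] [].
Qed.

Let size_ds : size ds = degree H v.
Proof. by rewrite -cardE. Qed.

Lemma card_edges_del1 : #|edges (del_verts H (A :\ v))| = #|S| + degree H v.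
Proof.
rewrite (edges_del1 indA vA) cardsU (_ : _ :&: _ = set0); last first.
  apply/eqP; rewrite -subset0; apply/subsetP => e /setIP[].
  by rewrite inE => /mapP[d /dsP[_ dS] ->]; rewrite -/S (negPf dS).
rewrite cards0 subn0 -size_ds addnC -(size_map fst) -(card_uniqP ds_uniq).
by congr (_ + _); apply: cardsE.
Qed.

Lemma drawn_del1 N k : odd (degree H v) -> drawn H N S k ->
  drawn H N (edges (del_verts H (A :\ v))) (k + (degree H v).+1).
Proof.
move=> odd_v dS; rewrite (edges_del1 indA vA) -size_ds.
apply: (drawn_odd_star (v := v)) => //; first by rewrite size_ds.
rewrite /isolated_in -subset0; apply/subsetP => d; rewrite inE => /andP[].
rewrite inE => dS' /eqP od; suff : d \in ds by move/dsP => [_]; rewrite dS'.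
by rewrite mem_enum mem_darts_at od eqxx andbT; move: dS'; rewrite inE => /andP[].
Qed.

End DeleteVertex.

Lemma edges_del0 H : edges (del_verts H set0) = edges H.
Proof. by apply/setP => e; rewrite !inE andbT. Qed.

Lemma card_edges_del H A : independent H A ->
  #|edges H| = #|edges (del_verts H A)| + \sum_(v in A) degree H v.
Proof.
have [n] := ubnP #|A|; elim: n A => // n IHn A ltA indA.
have [->|/set0Pn[v vA]] := eqVneq A set0.
  by rewrite edges_del0 big_set0 addn0.
rewrite (IHn (A :\ v)) ?(card_edges_del1 indA vA) //.
- by rewrite [in RHS](big_setD1 v) //= addnA.
- by move: ltA; rewrite (cardsD1 v) vA.
- exact: independent_subset (subsetDl _ _) indA.
Qed.

Lemma drawn_del H A N k : independent H A -> {in A, forall v, odd (degree H v)} ->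
  drawn H N (edges (del_verts H A)) k ->
  drawn H N (edges H) (k + \sum_(v in A) (degree H v).+1).
Proof.
have [n] := ubnP #|A|; elim: n A k => // n IHn A k ltA indA oddA dA.
have [A0|/set0Pn[v vA]] := eqVneq A set0.
  by move: dA; rewrite A0 edges_del0 big_set0 addn0.
rewrite (big_setD1 v) //= addnA; apply: IHn.
- by move: ltA; rewrite (cardsD1 v) vA.
- exact: independent_subset (subsetDl _ _) indA.
- by move=> u /setD1P[_ /oddA].
- by apply: drawn_del1 => //; apply: oddA.
Qed.

(** * Maximum genus and cycle rank under deletion *)

Lemma sum_odd_degree H A : {in A, forall v, odd (degree H v)} ->
  \sum_(v in A) degree H v = (\sum_(v in A) (degree H v)./2).*2 + #|A|.
Proof.
move=> oddA; rewrite -sum1_card -mul2n big_distrr -big_split /=.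
by apply: eq_bigr => v /oddA; lia.
Qed.

Lemma card_verts_del H A : independent H A ->
  #|verts H| = #|verts (del_verts H A)| + #|A|.
Proof. by case/andP=> AH _; rewrite cardsDS // subnK // subset_leq_card. Qed.

Lemma max_genus_del H A : connected (del_verts H A) -> independent H A ->
  {in A, forall v, odd (degree H v)} ->
  max_genus (del_verts H A) + \sum_(v in A) (degree H v)./2 <= max_genus H.
Proof.
set K := del_verts H A => connK indA oddA.
have /existsP[r /andP[rK /eqP euler]] := embeds_max_genus connK.
have rH : rotates H (dart_set (edges K)) r := rK.
(* Seen in [H], the deleted vertices are isolated, and each contributes one. *)
have fcH : face_count H (dart_set (edges K)) r = nb_faces K r + #|~: edges K| + #|A|.
  rewrite (nb_faces_face_count rK) /face_count -addnA; congr (_ + _).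
  have -> : isolated H (dart_set (edges K)) = isolated K (dart_set (edges K)) :|: A.
    apply/setP => v; rewrite in_setU !in_set -/(at_vertex K _ v).
    case: (boolP (v \in A)) => vA /=; last by rewrite orbF.
    rewrite (subsetP (andP indA).1) //= -subset0; apply/subsetP => d.
    rewrite !in_set => /andP[/andP[_ /andP[tA hA]] /eqP od]; move: vA; rewrite -od /origin.
    by case: ifP; rewrite ?(negPf tA) ?(negPf hA).
  rewrite cardsU (_ : _ :&: A = set0) ?cards0 ?subn0 //.
  by apply/setP => v; rewrite !in_set; case: (v \in A); rewrite ?andbF.
have dK : drawn H (face_count H (dart_set (edges K)) r + 0 + 0.*2) (edges K) 0.
  by exists r, 0.
have [r' [j [r'H eN]]] := drawn_del indA oddA dK.
have eE := card_edges_del indA; have eV := card_verts_del indA.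
have eD := sum_odd_degree oddA.
have eS : \sum_(v in A) (degree H v).+1 = \sum_(v in A) degree H v + #|A|.
  by rewrite -sum1_card -big_split; apply: eq_bigr => v _; rewrite /= addn1.
have eF := nb_faces_face_count r'H.
have cH := cardsC (edges H); have cK := cardsC (edges K).
(* The number of faces has dropped by exactly [j.*2], so the slack adds [j] to the genus. *)
suff emb : embeds_in_genus H (max_genus K + \sum_(v in A) (degree H v)./2 + j).
  by apply: leq_trans (leq_max_genus emb); apply: leq_addr.
apply/existsP; exists r'; apply/andP; split=> //; apply/eqP.
move: eN; rewrite -eF fcH eS eD => eN; rewrite eD -/K in eE; rewrite -/K in eV.
move: eN eE eV cH cK euler; clear; lia.
Qed.

Lemma cycle_rank_del H A : connected (del_verts H A) -> independent H A ->
  {in A, forall v, odd (degree H v)} ->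
  cycle_rank H = cycle_rank (del_verts H A) + (\sum_(v in A) (degree H v)./2).*2.
Proof.
(* [leVE] makes the truncated subtraction in the cycle rank of the smaller graph exact. *)
move=> connK indA oddA; have [leVE _] := max_genus_cycle_rank connK.
have := card_edges_del indA; have := card_verts_del indA.
rewrite (sum_odd_degree oddA) /cycle_rank; move: leVE; clear; lia.
Qed.

(** The lower bound on the genus and half the cycle rank increase by the same amount, so equality
    for the smaller graph carries over. *)
Lemma upper_embeddable_del H A : connected H -> connected (del_verts H A) ->
  independent H A -> {in A, forall v, odd (degree H v)} ->
  upper_embeddable (del_verts H A) -> upper_embeddable H.
Proof.
move=> connH connK indA oddA /eqP upK.
have [_ leH] := max_genus_cycle_rank connH.
rewrite /upper_embeddable eqn_leq leH /=.
have := max_genus_del connK indA oddA; rewrite upK (cycle_rank_del connK indA oddA).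
by rewrite halfD odd_double andbF add0n doubleK.
Qed.

End Genus.

Theorem theoremC (V E : finType) (G : mgraph V E) (s : nat) (A : nat -> {set V})
    (G_conn : connected G)
    (A_indep : forall i, 1 <= i <= s -> independent G (A i))
    (A_disj : forall i j, 1 <= i <= s -> 1 <= j <= s -> i != j ->
       [disjoint A i & A j])
    (Gi_conn : forall i, 1 <= i <= s -> connected (del_seq G A i))
    (A_odd : forall i, 1 <= i <= s ->
       forall v, v \in A i -> odd (degree (del_seq G A i.-1) v)) :
  (forall i, i < s ->
     ((max_genus (del_seq G A i))%:R >=
        2^-1 * (\sum_(v in A i.+1) ((degree (del_seq G A i) v)%:R - 1))
        + (max_genus (del_seq G A i.+1))%:R :> rat)%R) /\
  ((exists2 i, 1 <= i <= s & upper_embeddable (del_seq G A i)) ->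
     upper_embeddable G).
Proof.
(* Disjointness keeps the vertices of [A i.+1] present through the earlier deletions. *)
have indep i j : i < s -> j <= i -> independent (del_seq G A j) (A i.+1).
  move=> lt_is; elim: j => [|j IHj] lt_ji; first exact: A_indep.
  apply: independent_del; last exact: IHj (ltnW lt_ji).
  by apply: A_disj; rewrite ?(leq_trans lt_ji) ?(ltnW lt_is) // ltn_eqF.
have conn i : i <= s -> connected (del_seq G A i).
  by case: i => [_|i le_is] //; apply: Gi_conn.
have odd_deg i : i < s -> {in A i.+1, forall v, odd (degree (del_seq G A i) v)}.
  by move=> lt_is v vA; apply: (A_odd i.+1).
split=> [i lt_is|[i /andP[_]]].
  have le_g := max_genus_del (conn i.+1 lt_is) (indep i i lt_is (leqnn i)) (odd_deg i lt_is).
  rewrite big_split /= GRing.sumrN -GRing.natr_sum GRing.sumr_const.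
  (* For odd degrees, the rational sum of [d - 1] is twice the sum of the integer halves [d./2]. *)
  rewrite (sum_odd_degree (odd_deg i lt_is)) GRing.natrD GRing.addrK -mul2n GRing.natrM.
  by rewrite GRing.mulKf // -GRing.natrD Num.Theory.ler_nat addnC.
(* Upper embeddability passes from each graph to its predecessor, down to index 0, which is [G]. *)
elim: i => // i IHi lt_is up; apply: IHi (ltnW lt_is) _.
exact: upper_embeddable_del (conn i (ltnW lt_is)) (conn i.+1 lt_is)
  (indep i i lt_is (leqnn i)) (odd_deg i lt_is) up.
Qed.
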